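(* Let $G$ be a reductive Lie group, i.e. $(G,K,\theta,B)$ belongs to the Harish-Chandra class, with Lie algebra $\mathfrak{g}$ and Cartan decomposition $\mathfrak{g}=\mathfrak{k}+\mathfrak{p}$. Let $G$ be equipped with the left invariant Riemannian metric determined by the inner product $\langle X,Y\rangle=-B(X,\theta Y)$ on $\mathfrak{g}$, and let $R$ be its curvature tensor. For $u\in\mathfrak{g}$ write $u=u_1+u_2$ with $u_1\in\mathfrak{p}$, $u_2\in\mathfrak{k}$ (and similarly for $v$). Then for all $u,v\in\mathfrak{g}$, $$\langle R(u,v)v,u\rangle=-2\|[u_1,v_1]\|^2+\frac14\|[u,v]\|^2+2\langle[u_1,v_1],[u_2,v_2]\rangle.$$ Consequently: (1) if $u,v\in\mathfrak{p}$, then $\langle R(u,v)v,u\rangle=-\frac74\|[u,v]\|^2\le0$; (2) if $u,v\in\mathfrak{k}$, then $\langle R(u,v)v,u\rangle=\frac14\|[u,v]\|^2\ge0$; (3) if $u\in\mathfrak{p}$ and $v\in\mathfrak{k}$, then $\langle R(u,v)v,u\rangle=\frac14\|[u,v]\|^2\ge0$; (4) if $u\in\mathfrak{g}$ and $v\in\mathfrak{k}$, then $\langle R(u,v)v,u\rangle=\frac14\|[u,v]\|^2\ge0$; (5) if $u\in\mathfrak{g}$ and $v\in\mathfrak{p}$, then $\langle R(u,v)v,u\rangle=-\frac74\|[u_1,v]\|^2+\frac14\|[u_2,v]\|^2$.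
   Context: The Harish-Chandra class consists of 4-tuples $(G,K,\theta,B)$, where $G$ is a Lie group with Lie algebra $\mathfrak{g}$, $K$ is a compact subgroup of $G$, $\theta$ is a Lie algebra involution of $\mathfrak{g}$, and $B$ is a nondegenerate, $\mathrm{Ad}(G)$-invariant, symmetric bilinear form on $\mathfrak{g}$ such that: (i) $\mathfrak{g}$ is reductive, i.e. $\mathfrak{g}=\mathfrak{g}_1+\mathfrak{z}$ with $\mathfrak{g}_1=[\mathfrak{g},\mathfrak{g}]$ and $\mathfrak{z}$ the center of $\mathfrak{g}$; (ii) $\mathfrak{g}=\mathfrak{k}+\mathfrak{p}$ (the Cartan decomposition), where $\mathfrak{k}$ is the $+1$-eigenspace and $\mathfrak{p}$ the $-1$-eigenspace of $\theta$; (iii) $\mathfrak{k}$ and $\mathfrak{p}$ are orthogonal with respect to $B$, and $B$ is negative definite on $\mathfrak{k}$ and positive definite on $\mathfrak{p}$; (iv) the multiplication map $K\times\exp\mathfrak{p}\to G$ is a surjective diffeomorphism; (v) for every $g\in G$, the automorphism $\mathrm{Ad}(g)$, extended to the complexification $\mathfrak{g}^{\mathbb{C}}$, lies in the group $\mathrm{Int}\,\mathfrak{g}^{\mathbb{C}}$ of inner automorphisms; (vi) the analytic subgroup of $G$ with Lie algebra $\mathfrak{g}_1$ has finite center. The form $\langle X,Y\rangle=-B(X,\theta Y)$ is then an inner product on $\mathfrak{g}$; $\|u\|=\langle u,u\rangle^{1/2}$. An element $u\in\mathfrak{g}$ is also identified with the left invariant vector field on $G$ whose value at the identity is $u$. $\nabla$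 is the Levi-Civita connection; for left invariant fields it is given by $\langle\nabla_uv,w\rangle=\frac12(\langle[u,v],w\rangle-\langle[v,w],u\rangle-\langle[u,w],v\rangle)$, equivalently $\nabla_uv=\frac12([u,v]-[u,\theta v]-[v,\theta u])$. The curvature tensor is $R(u,v)w=\nabla_u(\nabla_vw)-\nabla_v(\nabla_uw)-\nabla_{[u,v]}w$. *)

(* Defs.v *)
From HB Require Import structures.
From mathcomp Require Import all_boot all_order all_algebra.
From mathcomp Require Import all_classical all_reals all_analysis.

Set Implicit Arguments.
Unset Strict Implicit.
Unset Printing Implicit Defensive.

Import Order.TTheory GRing.Theory Num.Theory.
Import numFieldNormedType.Exports.
Local Open Scope classical_set_scope.
Local Open Scope ring_scope.

(* No compatibility between the topology and the group law is required here:
   it is a consequence of [lie_group] below. *)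
#[short(type="groupTopologicalType")]
HB.structure Definition GroupTopological := {G of Topological G & Group G}.

Section SmoothMaps.
Variables (R : realType) (V W : normedModType R).

(* For finite-dimensional V and open U this is the usual class C^k. *)
Fixpoint Ck_on (k : nat) (U : set V) (f : V -> W) : Prop :=
  if k is k'.+1 then
    (forall x, U x -> differentiable f x) /\
    (forall v : V, Ck_on k' U (fun x => 'D_v f x))
  else forall x, U x -> {for x, continuous f}.

Definition smooth_on (U : set V) (f : V -> W) : Prop := forall k, Ck_on k U f.

End SmoothMaps.

Section Manifold.
Variables (R : realType) (n : nat) (G : groupTopologicalType).

(* Only the values of chart_fun on chart_dom, and of chart_inv on chart_cod,
   are meaningful. *)
Record chart := Chart {
  chart_dom : set G;
  chart_fun : G -> 'rV[R]_n;
  chart_inv : 'rV[R]_n -> G }.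

Definition chart_cod (c : chart) : set 'rV[R]_n := chart_fun c @` chart_dom c.

Record is_chart (c : chart) : Prop := IsChart {
  chart_dom_open : open (chart_dom c);
  chart_cod_open : open (chart_cod c);
  chart_funK : forall a, chart_dom c a -> chart_inv c (chart_fun c a) = a;
  chart_fun_cont : forall a, chart_dom c a -> {for a, continuous (chart_fun c)};
  chart_inv_cont : forall x, chart_cod c x -> {for x, continuous (chart_inv c)}
}.

Record is_manifold (A : set chart) : Prop := IsManifold {
  manifold_hausdorff : hausdorff_space G;
  manifold_countable : @second_countable G;
  atlas_chart : forall c, A c -> is_chart c;
  atlas_cover : forall a : G, exists2 c, A c & chart_dom c a;
  atlas_compat : forall c d, A c -> A d ->
    smooth_on (chart_cod c `&` chart_inv c @^-1` chart_dom d)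
              (chart_fun d \o chart_inv c)
}.

Variable A : set chart.

Definition smooth_to (V : normedModType R) (U : set V) (F : V -> G) : Prop :=
  (forall x, U x -> {for x, continuous F}) /\
  (forall c, A c ->
     smooth_on (U `&` F @^-1` chart_dom c) (chart_fun c \o F)).

Definition smooth_fun (f : G -> R) : Prop :=
  forall c, A c -> smooth_on (chart_cod c) (f \o chart_inv c : _ -> R^o).

Definition smooth_map (F : G -> G) : Prop :=
  forall c, A c -> smooth_to (chart_cod c) (F \o chart_inv c).

Record lie_group : Prop := LieGroup {
  lie_manifold : is_manifold A;
  lie_mul_smooth : forall c d, A c -> A d ->
    smooth_to (chart_cod c `*` chart_cod d)
      (fun xy : 'rV[R]_n * 'rV[R]_n =>
         (chart_inv c xy.1 * chart_inv d xy.2)%g);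
  lie_inv_smooth : smooth_map (fun a : G => a^-1%g)
}.

(* Smooth vector fields are derivations of C^oo(G); the values of D on
   functions that are not smooth are irrelevant. *)
Record left_invariant_field (D : (G -> R) -> G -> R) : Prop := LeftInvariant {
  lif_smooth : forall f, smooth_fun f -> smooth_fun (D f);
  lif_linear : forall (c : R) f h a, smooth_fun f -> smooth_fun h ->
    D (fun x => c * f x + h x) a = c * D f a + D h a;
  lif_leibniz : forall f h a, smooth_fun f -> smooth_fun h ->
    D (fun x => f x * h x) a = D f a * h a + f a * D h a;
  lif_invariant : forall b f a, smooth_fun f ->
    D (fun x => f (b * x)%g) a = D f (b * a)%g
}.

Definition is_subgroup (H : set G) : Prop :=
  [/\ H 1%g, forall a b, H a -> H b -> H (a * b)%g
    & forall a, H a -> H a^-1%g].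

Definition generated_subgroup (S : set G) : set G :=
  [set a | forall H, is_subgroup H -> S `<=` H -> H a].

Definition group_center (H : set G) : set G :=
  [set z | H z /\ forall a, H a -> (z * a = a * z)%g].

End Manifold.

Section LieAlgebra.
Variables (R : realType) (n : nat) (G : groupTopologicalType).
Variable A : set (chart R n G).
Variable g : vectType R.
Variable br : g -> g -> g.
Variable lf : g -> (G -> R) -> G -> R.

(* (g, br) is the Lie algebra of G: lf identifies g with the left invariant
   vector fields on G, and br with their commutator. *)
Record lie_algebra_of : Prop := LieAlgebraOf {
  lf_field : forall u, left_invariant_field A (lf u);
  lf_linear : forall (c : R) u v f a, smooth_fun A f ->
    lf (c *: u + v) f a = c * lf u f a + lf v f a;
  lf_inj : forall u,
    (forall f a, smooth_fun A f -> lf u f a = 0) -> u = 0;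
  lf_surj : forall D, left_invariant_field A D ->
    exists u, forall f a, smooth_fun A f -> lf u f a = D f a;
  lf_bracket : forall u v f a, smooth_fun A f ->
    lf (br u v) f a = lf u (lf v f) a - lf v (lf u f) a
}.

Record is_exponential (expG : g -> G) : Prop := IsExponential {
  exp_add : forall (s t : R) u,
    expG ((s + t) *: u) = (expG (s *: u) * expG (t *: u))%g;
  exp_smooth : forall u, smooth_to A setT (fun t : R^o => expG (t *: u));
  exp_velocity : forall u f, smooth_fun A f ->
    is_derive (0 : R^o) 1 (fun t : R^o => f (expG (t *: u)) : R^o) (lf u f 1%g)
}.

(* Ad a u is the image of the left invariant field u under the differential of
   the conjugation x |-> a x a^-1. *)
Definition Ad (a : G) (u : g) : g :=
  xget 0 [set w | forall f b, smooth_fun A f ->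
                    lf w f b = lf u (fun x => f (x * a^-1)%g) (b * a)%g].

Definition derived_algebra : set g :=
  [set u | exists s : seq (g * g), u = \sum_(p <- s) br p.1 p.2].

Definition lie_center : set g := [set u | forall v, br u v = 0].

(* The connected Lie subgroup of G with Lie algebra h. *)
Definition analytic_subgroup (expG : g -> G) (h : set g) : set G :=
  generated_subgroup (expG @` h).

(* The pair (x, y) stands for the element x + i y of the complexification. *)
Definition brC (z w : g * g) : g * g :=
  (br z.1 w.1 - br z.2 w.2, br z.1 w.2 + br z.2 w.1).

(* E = exp (ad z) on the complexification; convergence in a finite-dimensional
   space is tested on linear forms. *)
Definition is_exp_ad (z : g * g) (E : g * g -> g * g) : Prop :=
  forall (w : g * g) (phi : {scalar (g * g)%type}),
    (fun N : nat => \sum_(k < N) (k`!%:R)^-1 * phi (iter k (brC z) w))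
      @ \oo --> phi (E w).

(* Int of the complexification: the group generated by the exp (ad z); as
   exp (ad z)^-1 = exp (ad (- z)), products suffice. *)
Inductive inner_automorphismC : (g * g -> g * g) -> Prop :=
| inner_id : inner_automorphismC id
| inner_exp z E F : is_exp_ad z E -> inner_automorphismC F ->
    inner_automorphismC (E \o F).

Section HarishChandra.
Variable expG : g -> G.
Variable K : set G.
Variable theta : {linear g -> g}.
Variable B : g -> g -> R.

Definition kk : set g := [set u | theta u = u].
Definition pp : set g := [set u | theta u = - u].

(* The inverse of the multiplication map K x exp p -> G is a |-> (kap a, eps a).
   The multiplication map itself is a restriction of the smooth group law, and
   smoothness into the submanifolds K and exp p is smoothness into G. *)
Definition cartan_diffeomorphism : Prop :=
  exists kap eps : G -> G,
    [/\ smooth_map A kap /\ smooth_map A eps,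
        forall a, [/\ K (kap a), (expG @` pp) (eps a) & (kap a * eps a)%g = a]
      & forall k x, K k -> (expG @` pp) x ->
          kap (k * x)%g = k /\ eps (k * x)%g = x].

Record harish_chandra : Prop := HarishChandra {
  hc_K_subgroup : is_subgroup K;
  hc_K_compact : compact K;
  hc_theta_bracket : forall u v, theta (br u v) = br (theta u) (theta v);
  hc_theta_invol : forall u, theta (theta u) = u;
  hc_B_linear : forall v, scalar (B ^~ v);
  hc_B_sym : forall u v, B u v = B v u;
  hc_B_nondeg : forall u, (forall v, B u v = 0) -> u = 0;
  hc_B_Ad : forall a u v, B (Ad a u) (Ad a v) = B u v;
  hc_reductive : forall u,
    exists x y, [/\ derived_algebra x, lie_center y & u = x + y];
  hc_cartan : forall u, exists u1 u2, [/\ pp u1, kk u2 & u = u1 + u2];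
  hc_orthogonal : forall u v, kk u -> pp v -> B u v = 0;
  hc_B_neg : forall u, kk u -> u != 0 -> B u u < 0;
  hc_B_pos : forall u, pp u -> u != 0 -> 0 < B u u;
  hc_diffeo : cartan_diffeomorphism;
  hc_inner : forall a,
    inner_automorphismC (fun w : g * g => (Ad a w.1, Ad a w.2));
  hc_center : finite_set (group_center (analytic_subgroup expG derived_algebra))
}.

End HarishChandra.

Definition inner_prod (theta : {linear g -> g}) (B : g -> g -> R) (u v : g) : R :=
  - B u (theta v).

Definition inner_norm (theta : {linear g -> g}) (B : g -> g -> R) (u : g) : R :=
  Num.sqrt (inner_prod theta B u u).

(* A vector field on G is represented by a map xi : G -> g through the left
   trivialization of TG: its value at a is the value at a of the left invariant
   field xi a. Constant maps are the left invariant fields, and the left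
   invariant metric with value ip on g is (xi, eta) |-> ip (xi a) (eta a). *)
Definition smooth_field (xi : G -> g) : Prop :=
  forall phi : {scalar g}, smooth_fun A (fun a => phi (xi a)).

Definition field_act (xi : G -> g) (f : G -> R) : G -> R :=
  fun a => lf (xi a) f a.

Record levi_civita (ip : g -> g -> R)
    (nabla : (G -> g) -> (G -> g) -> G -> g) : Prop := LeviCivita {
  lc_smooth : forall xi eta, smooth_field xi -> smooth_field eta ->
    smooth_field (nabla xi eta);
  lc_linear_l : forall f xi xi' eta, smooth_fun A f ->
    smooth_field xi -> smooth_field xi' -> smooth_field eta ->
    forall a, nabla (fun x => f x *: xi x + xi' x) eta a =
              f a *: nabla xi eta a + nabla xi' eta a;
  lc_add_r : forall xi eta eta',
    smooth_field xi -> smooth_field eta -> smooth_field eta' ->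
    forall a, nabla xi (fun x => eta x + eta' x) a =
              nabla xi eta a + nabla xi eta' a;
  lc_leibniz : forall f xi eta, smooth_fun A f ->
    smooth_field xi -> smooth_field eta ->
    forall a, nabla xi (fun x => f x *: eta x) a =
              field_act xi f a *: eta a + f a *: nabla xi eta a;
  lc_torsion : forall xi eta f,
    smooth_field xi -> smooth_field eta -> smooth_fun A f ->
    forall a, field_act (fun x => nabla xi eta x - nabla eta xi x) f a =
              field_act xi (field_act eta f) a - field_act eta (field_act xi f) a;
  lc_metric : forall xi eta zeta,
    smooth_field xi -> smooth_field eta -> smooth_field zeta ->
    forall a, field_act xi (fun x => ip (eta x) (zeta x)) a =
              ip (nabla xi eta a) (zeta a) + ip (eta a) (nabla xi zeta a)
}.

(* R(u, v) w for left invariant u, v, w, as a vector field on G. *)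
Definition curvature (nabla : (G -> g) -> (G -> g) -> G -> g) (u v w : g) :
    G -> g := fun a =>
  nabla (cst u) (nabla (cst v) (cst w)) a
  - nabla (cst v) (nabla (cst u) (cst w)) a
  - nabla (cst (br u v)) (cst w) a.

End LieAlgebra.

(* Main.v *)
(* Differentiating B(Ad(exp tw)u, Ad(exp tw)v) = B(u, v) at t = 0 shows that B is
   invariant under the adjoint representation of the Lie algebra. The Koszul
   formula then determines the Levi-Civita connection on left invariant fields,
   nabla_u v = ([u,v] - [u, theta v] - [v, theta u])/2, and metricity gives
   <R(u,v)v,u> = - <nabla_v v, nabla_u u> + <nabla_v u, nabla_u v>
   - <nabla_[u,v] v, u>. Expanding in a = [u1,v1], b = [u2,v2], c = [u1,v2],
   d = [u2,v1], where a, b lie in k and c, d in p, leaves only the term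
   <[v1,v2],[u1,u2]> = - <c,d> - <a,b>, which is the Jacobi identity. *)
Require Import Defs.
From HB Require Import structures.
From mathcomp Require Import all_boot all_order all_algebra ring lra.
From mathcomp Require Import all_classical all_reals all_analysis.
Set Implicit Arguments.
Unset Strict Implicit.
Unset Printing Implicit Defensive.
Import Order.TTheory GRing.Theory Num.Theory.
Import numFieldNormedType.Exports.
Local Open Scope classical_set_scope.
Local Open Scope ring_scope.

(** Differentiating $B$ along $\mathrm{Ad}(\exp tw)$ is the laborious step. The space [g] is a
    [vectType] without topology, and [Ad] is known only through its action on smooth functions, so
    the curve $\mathrm{Ad}(\exp tw)u$ is observed through the forms [u |-> lf u f 1]. These forms
    separate points, finitely many of them already give coordinates, and $B$ becomes a finite sum of
    products of real functions of $t$. Smoothness is given only in charts, hence the need for a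
    chain rule for [Ck_on] before the symmetry of second derivatives can be applied. The operator
    [nabla] is arbitrary subject to its axioms. The Koszul argument is carried out at each point
    [a]; as its outcome does not depend on [a], [nabla] maps two constant fields to a constant
    field, which makes the iterated derivatives in [curvature] algebraic. *)

(** * Calculus of $C^k$ maps between normed spaces *)

Section CkCalculus.
Context {R : realType}.
Implicit Types V W X : normedModType R.

Lemma near_eq_differentiable {V W} (f g : V -> W) (x : V) :
  (\forall y \near x, f y = g y) -> differentiable f x -> differentiable g x.
Proof.
move=> fg df; have fgx : f x = g x := nbhs_singleton fg.
have [cdf /eqaddoP Hf] := (diff_locallyP x f).1 df.
have Hg : g \o shift x = cst (g x) + 'd f x +o_ 0 id.
  apply/eqaddoP => e e0; have := Hf e e0.
  have : \forall h \near (0 : V), f (h + x) = g (h + x).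
    by move: fg; rewrite (near_shift 0 x); apply: filterS => y /=; rewrite subr0.
  apply: filterS2 => h /= fgh.
  by rewrite -fgx !fctE /= -fgh.
apply/diff_locallyP; have E := diff_unique cdf Hg.
by rewrite E.
Qed.

Lemma Ck_on_sub {V W} k (U U' : set V) (f : V -> W) :
  U' `<=` U -> Ck_on k U f -> Ck_on k U' f.
Proof.
elim: k f => [|k IH] f sUU /=; first by move=> Hf x /sUU; apply: Hf.
move=> [df Hf]; split=> [x /sUU|v]; first exact: df.
exact: IH.
Qed.

(** The set in [Ck_on] only selects the points where conditions are imposed; the derivatives are
    those of the ambient space, so the property can be checked point by point. *)
Lemma Ck_on_local {V W} k (U : set V) (f : V -> W) :
  (forall x, U x -> exists2 U', U' x & Ck_on k U' f) -> Ck_on k U f.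
Proof.
elim: k f => [|k IH] f H /=; first by move=> x /H[U' /[swap]]; apply.
split=> [x /H[U' U'x [+ _]]|v]; first exact.
by apply: IH => x /H[U' U'x [_ H']]; exists U' => //; exact: H'.
Qed.

Lemma Ck_on_eq {V W} k (U : set V) (f g : V -> W) :
  open U -> (forall x, U x -> f x = g x) -> Ck_on k U f -> Ck_on k U g.
Proof.
move=> oU; elim: k f g => [|k IH] f g fg /=.
  move=> Hf x Ux; have := Hf x Ux.
  rewrite /prop_for /continuous_at -(fg x Ux); apply: cvg_trans.
  apply: near_eq_cvg.
  by near=> y; apply: fg; near: y; exact: open_nbhs_nbhs.
have nfg x : U x -> \forall y \near x, f y = g y.
  by move=> Ux; near=> y; apply: fg; near: y; exact: open_nbhs_nbhs.
move=> [df Hf]; split=> [x Ux|v].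
  by apply: near_eq_differentiable (df x Ux); exact: nfg.
apply: IH (Hf v) => x Ux.
by apply: near_eq_derive; exact: nfg.
Unshelve. all: by end_near. Qed.

Lemma Ck_on_continuous {V W} k (U : set V) (f : V -> W) (x : V) :
  Ck_on k U f -> U x -> {for x, continuous f}.
Proof.
case: k => [|k] /=; first by move=> H; exact: H.
by move=> [H _] Ux; apply: differentiable_continuous; exact: H.
Qed.

Lemma Ck_onW {V W} k (U : set V) (f : V -> W) :
  Ck_on k.+1 U f -> Ck_on k U f.
Proof.
elim: k f => [|k IH] f; first by move=> H x; exact: Ck_on_continuous H.
by move=> [df Hf]; split=> // v; apply: IH; exact: Hf.
Qed.

Lemma Ck_on_cst {V W} k (U : set V) (a : W) : Ck_on k U (cst a).
Proof.
elim: k a => [|k IH] a /=; first by move=> x _; exact: cst_continuous.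
split=> [x _|v]; first exact: differentiable_cst.
rewrite (_ : (fun x => _) = cst 0); first exact: IH.
by apply/funext => x; rewrite derive_cst.
Qed.

Lemma Ck_onD {V W} k (U : set V) (f g : V -> W) : open U ->
  Ck_on k U f -> Ck_on k U g -> Ck_on k U (f \+ g).
Proof.
move=> oU; elim: k f g => [|k IH] f g /=.
  by move=> Hf Hg x Ux; apply: continuousD; [exact: Hf|exact: Hg].
move=> [df Hf] [dg Hg]; split=> [x Ux|v].
  by apply: differentiableD; [exact: df|exact: dg].
apply: Ck_on_eq (IH _ _ (Hf v) (Hg v)) => // x Ux /=.
by rewrite deriveD//; apply: diff_derivable; [exact: df|exact: dg].
Qed.

Lemma Ck_on_sum {V W} (I : Type) (r : seq I) k (U : set V) (f : I -> V -> W) :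
  open U -> (forall i, Ck_on k U (f i)) ->
  Ck_on k U (fun x => \sum_(i <- r) f i x).
Proof.
move=> oU Hf; elim: r => [|i r IH].
  rewrite (_ : (fun x => _) = cst 0); first exact: Ck_on_cst.
  by apply/funext => x; rewrite big_nil.
rewrite (_ : (fun x => _) = f i \+ (fun x => \sum_(i <- r) f i x)).
  exact: Ck_onD.
by apply/funext => x; rewrite big_cons.
Qed.

Section Scale.
Variables (V W : normedModType R).

Let scale_bilinear : bilinear_for
  (GRing.Scale.Law.clone _ _ *:%R _) (GRing.Scale.Law.clone _ _ *:%R _)
  (fun (k : R^o) (w : W) => k *: w).
Proof.
split=> [w|k] a x y /=; first by rewrite scalerDl scalerA.
by rewrite scalerDr !scalerA [k * a]mulrC.
Qed.

(** The product rule is the chain rule for the continuous bilinear map [(k, w) |-> k *: w] after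
    [y |-> (c y, f y)]. *)
Lemma is_diff_scale (c : V -> R^o) (f : V -> W) x :
  differentiable c x -> differentiable f x ->
  is_diff x (fun y => c y *: f y)
    (fun h => c x *: 'd f x h + 'd c x h *: f x).
Proof.
move=> dc df.
pose bM := bilinear_isBilinear.Build R R^o W W _ _ _ scale_bilinear.
pose b : {bilinear R^o -> W -> W} := HB.pack (fun (k : R^o) (w : W) => k *: w) bM.
have bc : continuous (fun p : R^o * W => b p.1 p.2).
  by move=> p; exact: scale_continuous.
have db p : is_diff p (fun q : R^o * W => b q.1 q.2)
    (fun q => b p.1 q.2 + b q.1 p.2).
  by apply: DiffDef; [exact: differentiable_bilin|exact: diff_bilin].
have -> : (fun y => c y *: f y) =
  (fun q : R^o * W => b q.1 q.2) \o (fun y => (c y, f y)) by [].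
have /differentiableP ? := dc; have /differentiableP ? := df.
by apply: is_diff_eq.
Qed.

End Scale.

Lemma Ck_onZ {V W} k (U : set V) (c : V -> R^o) (f : V -> W) : open U ->
  Ck_on k U c -> Ck_on k U f -> Ck_on k U (fun x => c x *: f x).
Proof.
move=> oU; elim: k c f => [|k IH] c f.
  by move=> Hc Hf x Ux; apply: continuousZ; [exact: Hc|exact: Hf].
move=> Hc Hf; have [[dc Hc'] [df Hf']] := (Hc, Hf).
have D x : U x -> is_diff x (fun y => c y *: f y)
    (fun h => c x *: 'd f x h + 'd c x h *: f x).
  by move=> Ux; apply: is_diff_scale; [exact: dc|exact: df].
split=> [x Ux|v]; first by have [] := D x Ux.
have := Ck_onD oU (IH _ _ (Ck_onW Hc) (Hf' v)) (IH _ _ (Hc' v) (Ck_onW Hf)).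
apply: Ck_on_eq => // x Ux /=.
have [dcf E] := D x Ux.
by rewrite !deriveE ?E//; [exact: dc|exact: df].
Qed.

Lemma Ck_on_linear_comp {V W X} k (U : set V) (F : V -> W)
    (L : {linear W -> X}) : continuous L -> open U -> Ck_on k U F ->
  Ck_on k U (L \o F).
Proof.
move=> cL oU; elim: k F => [|k IH] F /=.
  move=> HF x Ux; apply: continuous_comp; [exact: HF|exact: cL].
move=> [dF HF]; split=> [x Ux|v].
  by apply: differentiable_comp; [exact: dF|exact: linear_differentiable].
apply: Ck_on_eq (IH _ (HF v)) => // x Ux /=.
have dL : differentiable L (F x) by exact: linear_differentiable.
have dFx := dF x Ux.
rewrite [RHS]deriveE; last exact: differentiable_comp.
by rewrite diff_comp// deriveE//= diff_lin.
Qed.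

Lemma Ck_on_pair {V W X} k (U : set V) (F : V -> W) (H : V -> X) :
  open U -> Ck_on k U F -> Ck_on k U H -> Ck_on k U (fun x => (F x, H x)).
Proof.
move=> oU; elim: k F H => [|k IH] F H /=.
  by move=> HF HH x Ux; apply: cvg_pair; [exact: HF|exact: HH].
move=> [dF HF] [dH HH]; split=> [x Ux|v].
  by apply: differentiable_pair; [exact: dF|exact: dH].
apply: Ck_on_eq (IH _ _ (HF v) (HH v)) => // x Ux /=.
have dFx := dF x Ux; have dHx := dH x Ux.
rewrite [RHS]deriveE; last exact: differentiable_pair.
by rewrite diff_pair// !deriveE.
Qed.

(* A finite family of vectors with continuous coordinate forms, so that partial
   derivatives along the family compute the full differential. *)
Definition framed V := exists (I : finType) (e : I -> V)
  (c : I -> {linear V -> R^o}),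
  (forall i, continuous (c i)) /\ forall x, x = \sum_i c i x *: e i.

(** In the chain rule [f] is differentiated along ['D_v F x], a direction that moves with [x],
    whereas [Ck_on] controls fixed directions only. Expanding this direction in the frame of [W]
    leaves a finite sum of products to which the induction hypothesis and [Ck_onZ] apply. *)
Lemma Ck_on_comp {V W X} k (U : set V) (U' : set W) (F : V -> W) (f : W -> X) :
  framed W -> open U -> (forall x, U x -> U' (F x)) ->
  Ck_on k U F -> Ck_on k U' f -> Ck_on k U (f \o F).
Proof.
move=> [m [e [c [cc ce]]]] oU UU'; elim: k f => [|k IH] f.
  move=> HF Hf x Ux; apply: continuous_comp; [exact: HF|exact/Hf/UU'].
move=> HF [df Hf]; have [dF HF'] := HF; split=> [x Ux|v].
  by apply: differentiable_comp; [exact: dF|exact/df/UU'].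
pose h i x := (c i \o (fun x => 'D_v F x)) x *: ((fun y => 'D_(e i) f y) \o F) x.
have Hh : Ck_on k U (fun x => \sum_i h i x).
  apply: Ck_on_sum => // i; apply: Ck_onZ => //.
    by apply: Ck_on_linear_comp => //; exact: HF'.
  by apply: IH; [exact: Ck_onW|exact: Hf].
apply: Ck_on_eq Hh => // x Ux /=.
have dFx := dF x Ux; have dfx := df _ (UU' x Ux).
rewrite [RHS]deriveE; last exact: differentiable_comp.
rewrite diff_comp//=.
rewrite [X in _ = 'd f (F x) X]ce linear_sum.
by apply: eq_bigr => i _; rewrite linearZ /h/= !deriveE.
Qed.

Lemma framed_prod V W : framed V -> framed W -> framed (V * W)%type.
Proof.
move=> [I [e [c [cc ce]]]] [J [e' [c' [cc' ce']]]].
have fstL : linear (fst : V * W -> V) by [].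
have sndL : linear (snd : V * W -> W) by [].
pose p1 : {linear (V * W)%type -> V} :=
  HB.pack (fst : V * W -> V) (GRing.isLinear.Build _ _ _ _ _ fstL).
pose p2 : {linear (V * W)%type -> W} :=
  HB.pack (snd : V * W -> W) (GRing.isLinear.Build _ _ _ _ _ sndL).
exists (I + J)%type.
exists (fun k => match k with inl i => (e i, 0) | inr j => (0, e' j) end).
exists (fun k => match k with
  inl i => (c i \o p1 : {linear _ -> _}) | inr j => (c' j \o p2 : {linear _ -> _}) end).
split=> [[i|j] x|[x y]].
- by apply: continuous_comp; [exact: cvg_fst|exact: cc].
- by apply: continuous_comp; [exact: cvg_snd|exact: cc'].
rewrite big_sumType/=.
have -> : \sum_(i : I) c i x *: (e i, 0 : W) = (x, 0).
  rewrite [in RHS](ce x).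
  elim/big_rec2 : _ => [//|i a b _ ->].
  by rewrite -[_ *: (_, _)]/(_ *: _, _ *: _) scaler0 -[LHS]/(_, _) addr0.
have -> : \sum_(j : J) c' j y *: (0 : V, e' j) = (0, y).
  rewrite [in RHS](ce' y).
  elim/big_rec2 : _ => [//|i a b _ ->].
  by rewrite -[_ *: (_, _)]/(_ *: _, _ *: _) scaler0 -[LHS]/(_, _) addr0.
by rewrite -[RHS]/(x + 0, 0 + y) addr0 add0r.
Qed.

Lemma framed_rV n : framed ('rV[R]_n).
Proof.
have lc i : linear (fun x : 'rV[R]_n => x 0 i : R^o).
  by move=> a x y; rewrite !mxE.
pose c i : {linear 'rV[R]_n -> R^o} :=
  HB.pack (fun x : 'rV[R]_n => x 0 i : R^o)
    (GRing.isLinear.Build _ _ _ _ _ (lc i)).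
exists 'I_n, (fun i => delta_mx 0 i), c; split=> [i|x]; first exact: coord_continuous.
exact: row_sum_delta.
Qed.

End CkCalculus.

(** * Symmetry of second derivatives *)

Section Schwarz.
Context {R : realType} {V : normedModType R}.

Let second_difference (f : V -> R^o) (x v w : V) (t : R) :=
  f (t *: v + (t *: w + x)) - f (t *: w + x) - (f (t *: v + x) - f x).

Let second_differenceC f x v w t :
  second_difference f x v w t = second_difference f x w v t.
Proof. by rewrite /second_difference addrCA; ring. Qed.

(** The mean value theorem in the direction [v] turns the second difference into [t] times a
    difference of two values of ['D_v f], and the first-order expansion of ['D_v f] at [x] evaluates
    both. *)
Let second_difference_approx (f : V -> R^o) (x v w : V) (e : R) :
  (forall y, differentiable f y) -> differentiable ('D_v f) x -> 0 < e ->
  exists2 r, 0 < r & forall t, 0 < t -> t < r ->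
    `|second_difference f x v w t - t ^+ 2 * 'D_w ('D_v f) x| <= e * t ^+ 2.
Proof.
(* The expansion is used at displacements of norm at most [t * (|v| + |w|)] and [t * |v|]; [M]
   bounds the sum of both factors, and the added 1 makes it positive. *)
move=> df dh e0; pose M := 2 * `|v| + `|w| + 1.
have M0 : 0 < M by rewrite /M; have := normr_ge0 v; have := normr_ge0 w; lra.
have [_ /eqaddoP Hh] := (diff_locallyP x ('D_v f)).1 dh.
have /Hh/nbhs_ballP[d /= d0 Hd] : 0 < e / M by rewrite divr_gt0.
have {}Hd y : `|y| < d -> `|'D_v f (y + x) - ('D_v f x + 'd ('D_v f) x y)|
    <= e / M * `|y|.
  by move=> yd; apply: Hd; rewrite -ball_normE/= sub0r normrN.
exists (d / M) => [|t t0 td]; first by rewrite divr_gt0.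
have tdM : t * M < d by rewrite -ltr_pdivlMr.
pose phi s : R^o := f (s *: v + (t *: w + x)) - f (s *: v + x).
pose dphi s : R^o := 'D_v f (s *: v + (t *: w + x)) - 'D_v f (s *: v + x).
have dline (y : V) (s : R) : is_derive (s : R^o) 1 (fun s : R^o => f (s *: v + y) : R^o)
    ('D_v f (s *: v + y)).
  have dd : is_diff (s : R^o) (fun s : R^o => s *: v + y) (fun s => s *: v).
    by apply: is_diff_eq; apply/funext => z; rewrite /= addr0.
  have dfs := df (s *: v + y).
  have [dl El] := dd.
  have dc := differentiable_comp dl dfs.
  apply: DeriveDef; first exact: diff_derivable.
  rewrite deriveE// diff_comp// /= El scale1r deriveE//.
have Dphi s : is_derive (s : R^o) 1 phi (dphi s) by exact: is_deriveB.
have cphi : {within `[0, t], continuous phi}.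
  apply: continuous_subspaceT => s; apply: differentiable_continuous.
  by apply/derivable1_diffP; have [] := Dphi s.
have [xi xit Exi] := MVT t0 (fun s _ => Dphi s) cphi.
have {xit} /andP[xi0 xit] : 0 < xi < t by rewrite in_itv in xit.
have -> : second_difference f x v w t = t * dphi xi.
  rewrite mulrC -(subr0 t) -[RHS]Exi /second_difference /phi !scale0r !add0r.
  by rewrite subr0 opprB addrACA opprB addrACA; ring.
have tw0 := mulr_ge0 (ltW t0) (normr_ge0 w).
have tv0 := mulr_ge0 (ltW t0) (normr_ge0 v).
have xv : `|xi *: v| <= t * `|v|.
  by rewrite normrZ gtr0_norm// ler_wpM2r// ltW.
have xw : `|xi *: v + t *: w| <= t * `|v| + t * `|w|.
  apply: (le_trans (ler_normD _ _)); apply: lerD => //.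
  by rewrite normrZ gtr0_norm.
have E1 := Hd (xi *: v + t *: w) ltac:(rewrite /M in tdM; lra).
have E2 := Hd (xi *: v) ltac:(rewrite /M in tdM; lra).
have L : 'd ('D_v f) x (xi *: v + t *: w) =
    'd ('D_v f) x (xi *: v) + t *: 'd ('D_v f) x w.
  by rewrite linearD [X in _ + X]linearZ.
rewrite -addrA L in E1.
rewrite deriveE// /dphi.
set D1 := 'D_v f _ in E1 *; set D2 := 'D_v f (xi *: v + x) in E2 *.
set p := 'd _ x (xi *: v) in E1 E2; set q := 'd _ x w in E1 *.
have -> : t * (D1 - D2) - t ^+ 2 * q =
  t * ((D1 - ('D_v f x + (p + t *: q))) - (D2 - ('D_v f x + p))).
  by rewrite -[t *: q]/(t * q); ring.
rewrite normrM gtr0_norm//.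
rewrite [e * _](_ : _ = t * (e / M * (t * M))); last by field; rewrite gt_eqF.
apply: ler_wpM2l; first exact: ltW.
apply: (le_trans (ler_normB _ _)).
apply: (le_trans (lerD E1 E2)); rewrite -mulrDr.
apply: ler_wpM2l; first by rewrite divr_ge0 ?ltW.
rewrite /M; lra.
Qed.

Let close_quotients (S a b t e : R) : 0 < t ->
  `|S - t ^+ 2 * b| <= e / 2 * t ^+ 2 -> `|S - t ^+ 2 * a| <= e / 2 * t ^+ 2 ->
  `|a - b| <= 0 + e.
Proof.
move=> t0 Hb Ha; have t20 : 0 < t ^+ 2 by rewrite exprn_gt0.
rewrite add0r -(ler_pM2l t20) -[X in X * `|_|](gtr0_norm t20) -normrM.
rewrite [t ^+ 2 * (a - b)](_ : _ = (S - t ^+ 2 * b) - (S - t ^+ 2 * a)); last by ring.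
apply: (le_trans (ler_normB _ _)); apply: (le_trans (lerD Hb Ha)).
by rewrite -mulrDl -splitr mulrC.
Qed.

(** Both mixed derivatives are limits of the same quotient by [t ^+ 2], because the second
    difference is symmetric in [v] and [w]. Each approximation is taken with error [e / 2] at a
    common [t]. *)
Lemma derive_commute (f : V -> R^o) (x v w : V) :
  (forall y, differentiable f y) -> differentiable ('D_v f) x ->
  differentiable ('D_w f) x -> 'D_v ('D_w f) x = 'D_w ('D_v f) x.
Proof.
move=> df dv dw; apply/eqP; rewrite -subr_eq0 -normr_le0; apply/ler_addgt0Pr => e e0.
have [r r0 Hr] := second_difference_approx w df dv (divr_gt0 e0 (ltr0Sn R 1)).
have [s s0 Hs] := second_difference_approx v df dw (divr_gt0 e0 (ltr0Sn R 1)).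
pose t := Num.min r s / 2.
have m0 : 0 < Num.min r s by rewrite lt_min r0.
have t0 : 0 < t by rewrite divr_gt0.
have tm : t < Num.min r s by rewrite /t; lra.
have [tr ts] : t < r /\ t < s by move: tm; rewrite lt_min => /andP.
apply: (close_quotients t0 (Hr t t0 tr)).
by rewrite second_differenceC; exact: (Hs t t0 ts).
Qed.

End Schwarz.

Lemma open_setI_preimage {S T : topologicalType} (U : set S) (D : set T)
    (F : S -> T) :
  open U -> open D -> (forall x, U x -> {for x, continuous F}) ->
  open (U `&` F @^-1` D).
Proof.
move=> oU oD cF; rewrite openE => x [Ux DFx]; apply: filterI.
  exact: open_nbhs_nbhs.
by apply: (cF x Ux); exact: open_nbhs_nbhs.
Qed.

(** * Smooth maps into a manifold and into a Lie group *)

Section SmoothMaps.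
Context {R : realType} {n : nat} {G : groupTopologicalType}.
Variable A : set (chart R n G).
Hypothesis hA : is_manifold A.
Implicit Types V W : normedModType R.

Lemma smooth_to_local {V} (U : set V) (F : V -> G) :
  (forall x, U x -> exists2 U', U' x & smooth_to A U' F) -> smooth_to A U F.
Proof.
move=> H; split=> [x /H[U' U'x [+ _]]|c Ac k]; first exact.
apply: Ck_on_local => x [Ux cFx]; have [U' U'x [_ +]] := H x Ux.
by move=> /(_ c Ac k) ?; exists (U' `&` F @^-1` chart_dom c).
Qed.

Lemma smooth_to_eq {V} (U : set V) (F H : V -> G) : open U ->
  (forall x, U x -> F x = H x) -> smooth_to A U F -> smooth_to A U H.
Proof.
move=> oU FH [cF sF].
have cH x : U x -> {for x, continuous H}.
  move=> Ux; have := cF x Ux.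
  rewrite /prop_for /continuous_at -(FH x Ux); apply: cvg_trans.
  apply: near_eq_cvg; near=> y; apply: FH; near: y; exact: open_nbhs_nbhs.
split=> // c Ac k.
have UE : U `&` F @^-1` chart_dom c = U `&` H @^-1` chart_dom c.
  by apply/seteqP; split=> x /= [Ux]; rewrite ?FH// -FH.
rewrite -UE; apply: Ck_on_eq (sF c Ac k); last by move=> x [Ux _] /=; rewrite FH.
by apply: open_setI_preimage => //; apply: chart_dom_open; exact: atlas_chart Ac.
Unshelve. all: by end_near. Qed.

Lemma smooth_to_comp {V W} (U : set V) (U' : set W) (F : V -> W) (m : W -> G) :
  framed W -> open U -> (forall x, U x -> U' (F x)) ->
  smooth_on U F -> smooth_to A U' m -> smooth_to A U (m \o F).
Proof.
move=> fW oU UU' sF [cm sm].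
have cmF x : U x -> {for x, continuous (m \o F)}.
  move=> Ux; apply: continuous_comp; last exact/cm/UU'.
  exact: Ck_on_continuous (sF 0%N) Ux.
split=> // c Ac k.
apply: (@Ck_on_comp _ _ _ _ _ _ (U' `&` m @^-1` chart_dom c) F (chart_fun c \o m)) => //.
- by apply: open_setI_preimage => //; apply: chart_dom_open; exact: atlas_chart Ac.
- by move=> x [Ux ?]; split=> //; exact: UU'.
- by apply: Ck_on_sub (sF k) => x [].
- exact: sm.
Qed.

(** Near each point, a chart [c] around its image factors the map as
    [(f \o chart_inv c) \o (chart_fun c \o F)], a composite of smooth maps of normed spaces. *)
Lemma smooth_fun_comp {V} (U : set V) (F : V -> G) (f : G -> R) :
  open U -> smooth_to A U F -> smooth_fun A f ->
  smooth_on U (f \o F : V -> R^o).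
Proof.
move=> oU [cF sF] sf k; apply: Ck_on_local => x Ux.
have [c Ac cFx] := atlas_cover hA (F x); have hc := atlas_chart hA Ac.
have oU' : open (U `&` F @^-1` chart_dom c).
  by apply: open_setI_preimage => //; exact: chart_dom_open.
exists (U `&` F @^-1` chart_dom c) => //.
have : Ck_on k (U `&` F @^-1` chart_dom c)
    ((f \o chart_inv c : _ -> R^o) \o (chart_fun c \o F)).
  apply: (@Ck_on_comp _ _ _ _ _ _ (chart_cod c)) (sF c Ac k) (sf c Ac k) => //.
    exact: framed_rV.
  by move=> y [Uy Fy]; exists (F y).
by apply: Ck_on_eq => // y [Uy Fy] /=; rewrite (chart_funK hc).
Qed.

Lemma smooth_to_cst {V} (U : set V) (a : G) : smooth_to A U (cst a).
Proof.
split=> [x _|c _ k]; first exact: cst_continuous.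
by rewrite (_ : _ \o _ = cst (chart_fun c a))//; exact: Ck_on_cst.
Qed.

Lemma smooth_to_chart_inv c : A c -> smooth_to A (chart_cod c) (chart_inv c).
Proof.
move=> Ac; split; first exact: chart_inv_cont (atlas_chart hA Ac).
by move=> d Ad; exact: (atlas_compat hA Ac Ad).
Qed.

Lemma smooth_fun_cst (a : R) : smooth_fun A (cst a).
Proof.
move=> c _ k; rewrite (_ : _ \o _ = cst (a : R^o))//; exact: Ck_on_cst.
Qed.

End SmoothMaps.

Section LieGroup.
Context {R : realType} {n : nat} {G : groupTopologicalType}.
Variable A : set (chart R n G).
Hypothesis hG : lie_group A.
Let hA : is_manifold A := lie_manifold hG.

(** Locally the product is the group law read in a chart around [F x] and a chart around [H x],
    composed with the pair of coordinate maps. The chain rule then passes through a product of row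
    spaces, which is why [framed_prod] is needed. *)
Lemma smooth_to_mul {V : normedModType R} (U : set V) (F H : V -> G) :
  open U -> smooth_to A U F -> smooth_to A U H ->
  smooth_to A U (fun x => (F x * H x)%g).
Proof.
move=> oU [cF sF] [cH sH]; apply: smooth_to_local => x Ux.
have [c Ac cFx] := atlas_cover hA (F x); have hc := atlas_chart hA Ac.
have [d Ad dHx] := atlas_cover hA (H x); have hd := atlas_chart hA Ad.
have oF : open (U `&` F @^-1` chart_dom c).
  by apply: open_setI_preimage => //; exact: chart_dom_open.
have oH : open (U `&` H @^-1` chart_dom d).
  by apply: open_setI_preimage => //; exact: chart_dom_open.
pose U' := (U `&` F @^-1` chart_dom c) `&` (U `&` H @^-1` chart_dom d).
have oU' : open U' by exact: openI.
exists U' => //; have := lie_mul_smooth hG Ac Ad.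
set m := (fun _ => _) => sm.
have := @smooth_to_comp _ _ _ A hA _ _ U' (chart_cod c `*` chart_cod d)
  (fun x => (chart_fun c (F x), chart_fun d (H x))) m.
move=> /(_ (framed_prod (framed_rV n) (framed_rV n)) oU').
have UU : forall x0, U' x0 ->
  (chart_cod c `*` chart_cod d) (chart_fun c (F x0), chart_fun d (H x0)).
  by move=> y [[_ Fy] [_ Hy]]; split=> /=; [exists (F y)|exists (H y)].
move=> /(_ UU) {UU}.
have sP : smooth_on U' (fun x => (chart_fun c (F x), chart_fun d (H x))).
  move=> k; apply: Ck_on_pair => //.
    by apply: Ck_on_sub (sF c Ac k) => y [].
  by apply: Ck_on_sub (sH d Ad k) => y [].
move=> /(_ sP sm); apply: smooth_to_eq => // y [[_ Fy] [_ Hy]].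
by rewrite /m /= (chart_funK hc)// (chart_funK hd).
Qed.

Lemma smooth_fun_mulr (f : G -> R) a : smooth_fun A f ->
  smooth_fun A (fun x => f (x * a)%g).
Proof.
move=> sf c Ac; have oc := chart_cod_open (atlas_chart hA Ac).
apply: (smooth_fun_comp hA oc _ sf).
apply: smooth_to_mul => //; first exact: smooth_to_chart_inv.
exact: smooth_to_cst.
Qed.

Lemma smooth_fun_mull (f : G -> R) a : smooth_fun A f ->
  smooth_fun A (fun x => f (a * x)%g).
Proof.
move=> sf c Ac; have oc := chart_cod_open (atlas_chart hA Ac).
apply: (smooth_fun_comp hA oc _ sf).
apply: smooth_to_mul => //; last exact: smooth_to_chart_inv.
exact: smooth_to_cst.
Qed.

End LieGroup.

(** This links directional derivatives to the one-variable derivatives in which [is_exponential] is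
    stated. *)
Lemma is_derive_line {R : realType} {V W : normedModType R} (f : V -> W)
    (v x : V) :
  differentiable f x ->
  is_derive (0 : R^o) 1 (fun t : R^o => f (t *: v + x)) ('D_v f x).
Proof.
move=> df; apply: DeriveDef.
  exact: (proj1 (derivable1P f x v) (@diff_derivable _ _ _ f x v df)).
rewrite /derive; set q := fun h => h^-1 *: _; set q' := fun h => h^-1 *: _.
suff -> : q = q' by [].
by apply/funext => h; rewrite /q /q' /= addr0 scale0r add0r [_%:A]mulr1.
Qed.

Lemma Ck_on_linear {R : realType} {V W : normedModType R} k (U : set V)
    (L : {linear V -> W}) : continuous L -> open U -> Ck_on k U L.
Proof.
move=> cL oU; apply: (@Ck_on_linear_comp _ _ _ _ _ _ id) => //.
case: k => [|k] /=; first by move=> x _.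
split=> [x _|v]; first exact: ex_diff.
rewrite (_ : (fun x => _) = cst v); first exact: Ck_on_cst.
by apply/funext => x; rewrite derive_id.
Qed.

Lemma framed_regular {R : realType} : framed (R^o : normedModType R).
Proof.
exists unit, (fun=> 1), (fun=> idfun); split=> [_ x //|x].
by rewrite big_const card_unit/= addr0 [_ *: _]mulr1.
Qed.

(** * Finite coordinates from a separating family of linear forms *)

Section SeparatingForms.
Context {R : realType} {g : vectType R}.
Variable P : 'Hom(g, R^o) -> Prop.
Hypothesis sepP : forall u, (forall phi, P phi -> phi u = 0) -> u = 0.

(** Induction on a bound for the dimension: a form that does not vanish at some vector of [U] has a
    kernel meeting [U] in a smaller subspace. *)
Let separating_on (U : {vspace g}) : exists s : seq 'Hom(g, R^o),
  (forall phi, phi \in s -> P phi) /\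
  forall u, u \in U -> (forall phi, phi \in s -> phi u = 0) -> u = 0.
Proof.
elim: {U}(\dim U) {-2}U (leqnn (\dim U)) => [|d IH] U.
  rewrite leqn0 dimv_eq0 => /eqP ->; exists [::]; split=> // u.
  by rewrite memv0 => /eqP.
move=> dU; have [U0|U0] := eqVneq U 0%VS.
  by exists [::]; split=> // u; rewrite U0 memv0 => /eqP.
have [phi Pphi phiv] : exists2 phi, P phi & phi (vpick U) != 0.
  apply: contrapT => H; move: U0; rewrite -vpick0 => /eqP; apply.
  apply: sepP => phi Pphi; apply/eqP; apply: contrapT => /negP ?.
  by apply: H; exists phi.
have [|s [sP sU]] := IH (U :&: lker phi)%VS.
  rewrite -ltnS (leq_trans _ dU)// ltnNge; apply: contra phiv => le.
  have /eqP UE : (U :&: lker phi == U)%VS by rewrite eqEdim capvSl.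
  by have := memv_pick U; rewrite -{2}UE memv_cap memv_ker => /andP[].
exists (phi :: s); split=> [psi|u uU H].
  by rewrite inE => /predU1P[->|/sP].
apply: sU => [|psi ps]; last by apply: H; rewrite inE ps orbT.
by rewrite memv_cap uU memv_ker H ?inE ?eqxx.
Qed.

Lemma separating_coordinates : exists (m : nat) (phi : 'I_m -> 'Hom(g, R^o))
  (x : 'I_m -> g), (forall i, P (phi i)) /\
  forall u, u = \sum_(i < m) phi i u *: x i.
Proof.
have [s [sP sU]] := separating_on fullv.
pose m := size s; pose phi (i : 'I_m) := s`_i.
pose F (u : g) : 'rV[R]_m := \row_i phi i u.
have linF : linear F by move=> a u v; apply/rowP => i; rewrite !mxE linearP.
pose FL : {linear g -> 'rV[R]_m} :=
  HB.pack F (GRing.isLinear.Build _ _ _ _ _ linF).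
pose Phi := linfun FL.
have kPhi : lker Phi == 0%VS.
  rewrite -subv0; apply/subvP => u; rewrite memv_ker memv0 lfunE/= => /eqP Fu.
  apply/eqP; apply: (sU u (memvf _)) => psi ps.
  have is_ : (index psi s < m)%N by rewrite index_mem.
  have := congr1 (fun y : 'rV[R]_m => y 0 (Ordinal is_)) Fu.
  by rewrite !mxE /phi/= nth_index.
(* The joint map [Phi] of the forms is injective; its left inverse applied to the unit rows gives
   the vectors of the expansion. *)
exists m, phi, (fun i => (Phi^-1)%VF (delta_mx 0 i)); split=> [i|u].
  by apply: sP; exact: mem_nth.
rewrite -{1}(lker0_lfunK kPhi u) lfunE/= [F u]row_sum_delta linear_sum.
by apply: eq_bigr => i _; rewrite linearZ mxE.
Qed.

End SeparatingForms.

(** * The bracket and [Ad] computed through derivations *)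

Section LieAlgebra.
Context {R : realType} {n : nat} {G : groupTopologicalType}.
Variable A : set (chart R n G).
Hypothesis hG : lie_group A.
Variables (g : vectType R) (br : g -> g -> g) (lf : g -> (G -> R) -> G -> R).
Hypothesis hg : lie_algebra_of A br lf.

Lemma lf_mull u f b : smooth_fun A f ->
  lf u f b = lf u (fun x => f (b * x)%g) 1%g.
Proof. by move=> sf; rewrite (lif_invariant (lf_field hg u))// mulg1. Qed.

(** A left invariant field is determined by its value at the identity: left translation carries the
    hypothesis to every point, and [lf_inj] concludes. *)
Lemma lf_eq u v : (forall f, smooth_fun A f -> lf u f 1%g = lf v f 1%g) -> u = v.
Proof.
move=> H; apply/eqP; rewrite -subr_eq0; apply/eqP; apply: (lf_inj hg) => f a sf.
rewrite lf_mull// addrC -scaleN1r (lf_linear hg); last exact: smooth_fun_mull.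
by rewrite mulN1r H ?addNr//; exact: smooth_fun_mull.
Qed.

Lemma lf_smooth u f : smooth_fun A f -> smooth_fun A (lf u f).
Proof. by move=> sf; apply: (lif_smooth (lf_field hg u)). Qed.

(** The Leibniz rule for $1 = 1 \cdot 1$ kills the constant 1, and linearity gives the rest. *)
Lemma lf_cst u c a : lf u (cst c) a = 0.
Proof.
have s0 : smooth_fun A (cst 0) by exact: smooth_fun_cst.
have s1 : smooth_fun A (cst 1) by exact: smooth_fun_cst.
have E1 : lf u (cst 1) a = 0.
  have := lif_leibniz (lf_field hg u) a s1 s1.
  rewrite (_ : (fun x => _) = cst 1); last by apply/funext => x; rewrite /= mulr1.
  by rewrite /cst mulr1 mul1r; lra.
have E0 : lf u (cst 0) a = 0.
  have := lif_linear (lf_field hg u) 1 a s0 s0.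
  rewrite (_ : (fun x => _) = cst 0); first lra.
  by apply/funext => x; rewrite /= mulr0 addr0.
have := lif_linear (lf_field hg u) c a s1 s0.
rewrite (_ : (fun x => _) = cst c); first by rewrite E1 E0 mulr0 addr0.
by apply/funext => x; rewrite /= mulr1 addr0.
Qed.

Lemma lf0 f a : smooth_fun A f -> lf 0 f a = 0.
Proof.
move=> sf; have := lf_linear hg 1 0 0 a sf.
by rewrite scaler0 addr0 mul1r => /eqP; rewrite -subr_eq subrr eq_sym => /eqP.
Qed.

Lemma lfN u f a : smooth_fun A f -> lf (- u) f a = - lf u f a.
Proof.
by move=> sf; rewrite -[- u]addr0 -scaleN1r (lf_linear hg)// lf0// addr0 mulN1r.
Qed.

Lemma lf_field_linear u (c : R) v w f a : smooth_fun A f ->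
  lf u (lf (c *: v + w) f) a = c * lf u (lf v f) a + lf u (lf w f) a.
Proof.
move=> sf; rewrite -(lif_linear (lf_field hg u)); [|exact: lf_smooth..].
by congr (lf u _ a); apply/funext => x; rewrite (lf_linear hg).
Qed.

Lemma lf_fieldN u v f a : smooth_fun A f ->
  lf u (lf (- v) f) a = - lf u (lf v f) a.
Proof.
move=> sf; rewrite -[- v]addr0 -scaleN1r lf_field_linear// mulN1r.
rewrite (_ : lf 0 f = cst 0) ?lf_cst ?addr0//.
by apply/funext => x; rewrite lf0.
Qed.

(** [Ad] is picked by [xget] with default 0, so a candidate must be shown to exist. The field [u]
    moved by right translation is again left invariant, hence comes from [g] by [lf_surj]. *)
Lemma AdE a u f b : smooth_fun A f ->
  lf (Ad A lf a u) f b = lf u (fun x => f (x * a^-1)%g) (b * a)%g.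
Proof.
pose D f b := lf u (fun x => f (x * a^-1)%g) (b * a)%g.
have sm f' : smooth_fun A f' -> smooth_fun A (fun x => f' (x * a^-1)%g).
  exact: smooth_fun_mulr.
have lu := lf_field hg u.
have : left_invariant_field A D.
  split=> [f' sf|c f' h a' sf sh|f' h a' sf sh|b' f' a' sf]; rewrite /D.
  - by apply: (smooth_fun_mulr hG a (lf_smooth _ _)); exact: sm.
  - by rewrite (lif_linear lu)//; exact: sm.
  - by rewrite (lif_leibniz lu) ?mulgK//; exact: sm.
  - rewrite -mulgA -(lif_invariant lu b'); last exact: sm.
    by congr (lf u _ (a' * a)%g); apply/funext => x; rewrite mulgA.
move=> /(lf_surj hg)[w Hw] sf.
have := @xgetPex _ 0 [set w | forall f b, smooth_fun A f ->
  lf w f b = lf u (fun x => f (x * a^-1)%g) (b * a)%g].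
by apply; last exact: sf; exists w => f' b' sf'; exact: Hw.
Qed.

Lemma br_linear (v : g) : linear (br ^~ v : g -> g).
Proof.
move=> c u w; apply: lf_eq => f sf.
rewrite (lf_linear hg)// !(lf_bracket hg)// (lf_linear hg); last exact: lf_smooth.
by rewrite lf_field_linear//; ring.
Qed.

Lemma br_anti u v : br u v = - br v u.
Proof.
by apply: lf_eq => f sf; rewrite lfN// !(lf_bracket hg)// opprB.
Qed.

Let lf_fieldB u f h a : smooth_fun A f -> smooth_fun A h ->
  lf u (fun x => f x - h x) a = lf u f a - lf u h a.
Proof.
move=> sf sh; have := lif_linear (lf_field hg u) (-1) a sh sf.
rewrite mulN1r addrC => <-; congr (lf u _ a).
by apply/funext => x; rewrite mulN1r addrC.
Qed.

Lemma br_jacobi u v w : br u (br v w) = br (br u v) w + br v (br u w).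
Proof.
apply: lf_eq => f sf; have s2 x y : smooth_fun A (lf x (lf y f)).
  by do 2! apply: lf_smooth.
have E x y : lf (br x y) f = fun a => lf x (lf y f) a - lf y (lf x f) a.
  by apply/funext => a; rewrite (lf_bracket hg).
rewrite -[br (br u v) w]scale1r (lf_linear hg)// mul1r.
rewrite !(lf_bracket hg)//; try exact: lf_smooth.
by rewrite !E !lf_fieldB//; ring.
Qed.

End LieAlgebra.

(** * Infinitesimal invariance of the form under the adjoint action *)

Section Exponential.
Context {R : realType} {n : nat} {G : groupTopologicalType}.
Variable A : set (chart R n G).
Hypothesis hG : lie_group A.
Variables (g : vectType R) (br : g -> g -> g) (lf : g -> (G -> R) -> G -> R).
Hypothesis hg : lie_algebra_of A br lf.
Variable expG : g -> G.
Hypothesis hexp : is_exponential A lf expG.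
Let hA : is_manifold A := lie_manifold hG.

Lemma exp0 : expG 0 = 1%g.
Proof.
have := exp_add hexp 0 0 0; rewrite !scaler0 -[X in X = _]mulg1.
by move/(@mulgI _ (expG 0)).
Qed.

Lemma expN u (t : R) : expG (t *: - u) = (expG (t *: u))^-1%g.
Proof.
apply: (@mulgI _ (expG (t *: u))); rewrite mulgV scalerN -scaleNr.
by rewrite -(exp_add hexp) subrr scale0r exp0.
Qed.

Lemma exp_derive u b c f : smooth_fun A f ->
  is_derive (0 : R^o) 1 (fun t : R^o => f (b * expG (t *: u) * c)%g : R^o)
    (lf u (fun x => f (x * c)%g) b).
Proof.
move=> sf; have sc := smooth_fun_mulr hG c sf.
rewrite (lf_mull hg)//; apply: (exp_velocity hexp).
exact: (smooth_fun_mull hG b sc).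
Qed.

Lemma exp_derive1 u f : smooth_fun A f ->
  is_derive (0 : R^o) 1 (fun t : R^o => f (expG (t *: u)) : R^o) (lf u f 1%g).
Proof. exact: exp_velocity. Qed.

(* Both mixed terms of the derivative of [Ad (exp tw) u] at [t = 0] come from
   the function [f (exp(rw) exp(su) exp(-tw))] of [(r, s, t)]: this is where the
   symmetry of second derivatives enters. *)
Lemma Ad_exp_derive w u f : smooth_fun A f ->
  is_derive (0 : R^o) 1
    (fun t : R^o => lf (Ad A lf (expG (t *: w)) u) f 1%g : R^o)
    (lf (br w u) f 1%g).
Proof.
move=> sf; pose V : normedModType R := 'rV[R]_3.
have lc i : linear (fun x : V => x 0 i : R^o).
  by move=> a x y; rewrite !mxE.
pose c i : {linear V -> R^o} :=
  HB.pack (fun x : V => x 0 i : R^o) (GRing.isLinear.Build _ _ _ _ _ (lc i)).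
pose i0 : 'I_3 := 0; pose i1 : 'I_3 := 1; pose i2 : 'I_3 := 2%:R.
pose e i : V := delta_mx 0 i.
have ce i j : e i 0 j = (i == j)%:R by rewrite mxE eqxx eq_sym.
have sexp i v : smooth_to A setT (fun x : V => expG (x 0 i *: v)).
  apply: (@smooth_to_comp _ _ _ A hA _ _ setT setT (c i)
    (fun t : R^o => expG (t *: v))) => //.
  - exact: framed_regular.
  - exact: openT.
  - move=> k; apply: Ck_on_linear; last exact: openT.
    exact: coord_continuous.
  - exact: (exp_smooth hexp v).
pose m (x : V) := (expG (x 0 i0 *: w) * expG (x 0 i1 *: u) *
                   expG (x 0 i2 *: - w))%g.
have sm : smooth_to A setT m.
  by do 2! apply: (smooth_to_mul hG openT) => //.
pose E : V -> R^o := f \o m.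
have sE : smooth_on setT E by exact: (smooth_fun_comp hA openT sm sf).
have dE x : differentiable E x by case: (sE 2%N) => + _; apply.
have dDE v x : differentiable ('D_v E) x.
  by case: (sE 2%N) => _ /(_ v) [+ _]; apply.
have line i (y : V) t j : (t *: e i + y) 0 j = t * (i == j)%:R + y 0 j.
  by rewrite mxE [X in X + _]mxE ce.
(* Coordinates 0, 1, 2 are $r, s, t$. At $s = 0$ and $r = t$ the right-hand side is, by [AdE], the
   action of $\mathrm{Ad}(\exp tw)u$ on [f] at the identity. *)
have De1 (y : V) : y 0 i1 = 0 -> 'D_(e i1) E y =
    lf u (fun x => f (x * expG (y 0 i2 *: - w))%g) (expG (y 0 i0 *: w)).
  move=> y1; have Hline := is_derive_line (e i1) (dE y).
  have := exp_derive u (expG (y 0 i0 *: w)) (expG (y 0 i2 *: - w)) sf.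
  rewrite (_ : (fun t => _) = (fun t => E (t *: e i1 + y))).
    by move=> Hexp; rewrite -(@derive_val _ _ _ _ _ _ _ Hline) derive_val.
  by apply/funext => t; rewrite /E/= /m !line/= y1 mulr1 !mulr0 !add0r addr0.
have De2 (y : V) : y 0 i0 = 0 -> y 0 i2 = 0 -> 'D_(e i2) E y =
    lf (- w) f (expG (y 0 i1 *: u)).
  move=> y0 y2; have Hline := is_derive_line (e i2) (dE y).
  have := exp_derive (- w) (expG (y 0 i1 *: u)) 1%g sf.
  rewrite (_ : (fun t => _) = (fun t => E (t *: e i2 + y))).
    move=> Hexp; rewrite -(@derive_val _ _ _ _ _ _ _ Hline) derive_val.
    by congr (lf _ _ _); apply/funext => x; rewrite mulg1.
  apply/funext => t; rewrite /E/= /m !line/= y0 y2 mulr1 !mulr0 !add0r addr0.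
  by rewrite scale0r exp0 mul1g mulg1.
(* The curve is ['D_(e i1) E] along the diagonal direction $r = t$, so its derivative splits into
   one term for each of [e i0] and [e i2]. *)
have H := is_derive_line (e i0 + e i2) (dDE (e i1) 0).
have -> : (fun t : R^o => lf (Ad A lf (expG (t *: w)) u) f 1%g : R^o) =
    (fun t : R^o => 'D_(e i1) E (t *: (e i0 + e i2) + 0)).
  apply/funext => t.
  rewrite scalerDr -addrA De1 !line !mxE/= ?mulr0 ?mulr1 ?addr0 ?add0r//.
  by rewrite (AdE hG hg)// mul1g expN.
have -> : lf (br w u) f 1%g = 'D_(e i0 + e i2) ('D_(e i1) E) 0; last by [].
(* After the swap in the second term, [f] is differentiated first along [- w] and then along [u],
   giving [- lf u (lf w f) 1]; the first term gives [lf w (lf u f) 1]. *)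
rewrite deriveE// linearD/= -!deriveE// [X in _ + X]derive_commute// (lf_bracket hg)//.
congr (_ + _).
  have Hline := is_derive_line (e i0) (dDE (e i1) 0).
  have := exp_derive1 w (lf_smooth hg u sf).
  rewrite (_ : (fun t => _) = (fun t : R^o => 'D_(e i1) E (t *: e i0 + 0))).
    by move=> Hexp; rewrite -(@derive_val _ _ _ _ _ _ _ Hline) derive_val.
  apply/funext => t.
  rewrite De1 !line !mxE/= ?mulr0 ?mulr1 ?addr0 ?scale0r//.
  by rewrite exp0; congr (lf _ _ _); apply/funext => x; rewrite mulg1.
have Hline := is_derive_line (e i1) (dDE (e i2) 0).
have := exp_derive1 u (lf_smooth hg (- w) sf).
rewrite (_ : (fun t => _) = (fun t : R^o => 'D_(e i2) E (t *: e i1 + 0))).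
  move=> Hexp; rewrite -(lf_fieldN hg)//.
  by rewrite -(@derive_val _ _ _ _ _ _ _ Hline) derive_val.
apply/funext => t.
by rewrite De2 !line !mxE/= ?mulr0 ?mulr1 ?addr0.
Qed.

Section InvariantForm.
Variable B : g -> g -> R.
Hypothesis B_linear : forall v, scalar (B ^~ v).
Hypothesis B_sym : forall u v, B u v = B v u.
Hypothesis B_Ad : forall a u v, B (Ad A lf a u) (Ad A lf a v) = B u v.

(** In coordinates of the form [u |-> lf u f 1], the value of [B] on the two moving vectors is a
    finite sum of products of functions differentiated by [Ad_exp_derive]. By [B_Ad] this sum is
    constant in $t$, so the derivative given by the product rule vanishes. *)
Lemma invariant_form_ad w u v : B (br w u) v + B u (br w v) = 0.
Proof.
pose P (phi : 'Hom(g, R^o)) :=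
  exists2 f, smooth_fun A f & forall u, phi u = lf u f 1%g.
have sepP x : (forall phi, P phi -> phi x = 0) -> x = 0.
  move=> H; apply: (lf_eq hG hg) => f sf; rewrite (lf0 hg)//.
  have lin : linear (fun y => lf y f 1%g : R^o).
    by move=> c y z; rewrite (lf_linear hg).
  pose L : {linear g -> R^o} :=
    HB.pack (fun y => lf y f 1%g : R^o) (GRing.isLinear.Build _ _ _ _ _ lin).
  rewrite -(H (linfun L)); first by rewrite lfunE.
  by exists f => // y; rewrite lfunE.
have [m [phi [x [Pphi xE]]]] := separating_coordinates sepP.
pose b i j := B (x i) (x j).
have B_expand y z : B y z = \sum_(i < m) \sum_(j < m) b i j * (phi i y * phi j z).
  have lB v' : linear (B ^~ v' : g -> R^o) by exact: B_linear.
  pose BL v' : {linear g -> R^o} :=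
    HB.pack (B ^~ v' : g -> R^o) (GRing.isLinear.Build _ _ _ _ _ (lB v')).
  rewrite -[B y z]/(BL z y) [in LHS](xE y) linear_sum; apply: eq_bigr => i _.
  rewrite linearZ/= B_sym -[B z (x i)]/(BL (x i) z) [in LHS](xE z) linear_sum.
  rewrite scaler_sumr; apply: eq_bigr => j _.
  rewrite linearZ/= B_sym -/(b i j) -[_ *: (_ *: _)]/(_ * (_ * _)).
  by rewrite mulrA mulrC.
pose p y i (t : R^o) : R^o := phi i (Ad A lf (expG (t *: w)) y).
have dp y i : is_derive (0 : R^o) 1 (p y i) (phi i (br w y)).
  have [f sf phiE] := Pphi i.
  have := Ad_exp_derive w y sf; rewrite phiE.
  by rewrite (_ : p y i = fun t => lf (Ad A lf (expG (t *: w)) y) f 1%g)//;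
    apply/funext => t; rewrite /p phiE.
have p0 y i : p y i 0 = phi i y.
  have [f sf phiE] := Pphi i.
  rewrite /p scale0r exp0 !phiE (AdE hG hg)// mulg1.
  by congr (lf _ _ _); apply/funext => z; rewrite invg1 mulg1.
have dB : is_derive (0 : R^o) 1
    (\sum_(i < m) \sum_(j < m) b i j *: (p u i * p v j : R^o -> R^o))
    (\sum_(i < m) \sum_(j < m)
      b i j *: (p u i 0 *: phi j (br w v) + p v j 0 *: phi i (br w u))).
  exact: is_derive_sum.
have : is_derive (0 : R^o) 1 (cst (B u v) : R^o -> R^o) 0 by exact: is_derive_cst.
rewrite (_ : cst _ =
    \sum_(i < m) \sum_(j < m) b i j *: (p u i * p v j : R^o -> R^o)); last first.
  apply/funext => t; rewrite fct_sumE /cst -(B_Ad (expG (t *: w))) B_expand.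
  by apply: eq_bigr => i _; rewrite fct_sumE.
move=> dB0; have := @derive_val _ _ _ _ _ _ _ dB.
rewrite derive_val => E0; rewrite {}E0 !B_expand -big_split; apply: eq_bigr => i _.
rewrite -big_split; apply: eq_bigr => j _; rewrite !p0 -!/(_ * _)/=.
by rewrite -[_ *: (_ + _)]/(_ * (_ * _ + _ * _)); ring.
Qed.

End InvariantForm.
End Exponential.

(** * Algebra of the inner product, the Cartan decomposition and the connection *)

Section CartanAlgebra.
Context {R : realType} {g : vectType R}.
Variables (br : g -> g -> g) (theta : {linear g -> g}) (B : g -> g -> R).
Hypothesis br_lin : forall v : g, linear (br ^~ v : g -> g).
Hypothesis brC : forall u v, br u v = - br v u.
Hypothesis brJ : forall u v w, br u (br v w) = br (br u v) w + br v (br u w).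
Hypothesis theta_br : forall u v, theta (br u v) = br (theta u) (theta v).
Hypothesis thetaK : forall u, theta (theta u) = u.
Hypothesis B_lin : forall v, scalar (B ^~ v).
Hypothesis B_sym : forall u v, B u v = B v u.
Hypothesis B_nondeg : forall u, (forall v, B u v = 0) -> u = 0.
Hypothesis B_ad : forall w u v, B (br w u) v + B u (br w v) = 0.
Hypothesis cartan :
  forall u, exists u1 u2, [/\ pp theta u1, kk theta u2 & u = u1 + u2].
Hypothesis B_orth : forall u v, kk theta u -> pp theta v -> B u v = 0.

Local Notation ip := (inner_prod theta B).
Local Notation k := (kk theta).
Local Notation p := (pp theta).

Let BDl u u' v : B (u + u') v = B u v + B u' v.
Proof. by have := B_lin v 1 u u'; rewrite scale1r mul1r. Qed.

Let B0l v : B 0 v = 0.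
Proof. by apply: (addrI (B 0 v)); rewrite -BDl !addr0. Qed.

Let BZl c u v : B (c *: u) v = c * B u v.
Proof. by have := B_lin v c u 0; rewrite !addr0 B0l addr0. Qed.

Let BNl u v : B (- u) v = - B u v.
Proof. by rewrite -scaleN1r BZl mulN1r. Qed.

Let BDr u v v' : B u (v + v') = B u v + B u v'.
Proof. by rewrite ![B u _]B_sym BDl. Qed.

Let BNr u v : B u (- v) = - B u v.
Proof. by rewrite ![B u _]B_sym BNl. Qed.

(** [theta] acts by signs on two [B]-orthogonal summands. The symmetry of the inner product rests on
    this. *)
Lemma B_theta u v : B (theta u) (theta v) = B u v.
Proof.
have [u1 [u2 [pu ku ->]]] := cartan u; have [v1 [v2 [pv kv ->]]] := cartan v.
rewrite !(linearD theta) pu ku pv kv !(BDl, BDr, BNl, BNr).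
by rewrite (B_orth ku pv) (B_sym u1 v2) (B_orth kv pu); ring.
Qed.

Lemma inner_prodC u v : ip u v = ip v u.
Proof. by rewrite /inner_prod -[B u _]B_theta thetaK B_sym. Qed.

Lemma inner_prodDl u u' v : ip (u + u') v = ip u v + ip u' v.
Proof. by rewrite /inner_prod BDl opprD. Qed.

Lemma inner_prodNl u v : ip (- u) v = - ip u v.
Proof. by rewrite /inner_prod BNl. Qed.

Lemma inner_prodZl c u v : ip (c *: u) v = c * ip u v.
Proof. by rewrite /inner_prod BZl mulrN. Qed.

Lemma inner_prodDr u v v' : ip u (v + v') = ip u v + ip u v'.
Proof. by rewrite ![ip u _]inner_prodC inner_prodDl. Qed.

Lemma inner_prodNr u v : ip u (- v) = - ip u v.
Proof. by rewrite ![ip u _]inner_prodC inner_prodNl. Qed.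

Lemma inner_prod0l v : ip 0 v = 0.
Proof. by rewrite /inner_prod B0l oppr0. Qed.

Lemma inner_prod_eq u v : (forall w, ip u w = ip v w) -> u = v.
Proof.
move=> H; apply/eqP; rewrite -subr_eq0; apply/eqP; apply: B_nondeg => w.
rewrite -[w]thetaK; apply: oppr_inj; rewrite oppr0 -/(ip _ _).
by rewrite inner_prodDl inner_prodNl H subrr.
Qed.

Lemma inner_prod_kp x y : k x -> p y -> ip x y = 0.
Proof. by move=> kx py; rewrite /inner_prod py BNr (B_orth kx py) !oppr0. Qed.

Lemma inner_prod_pk x y : p x -> k y -> ip x y = 0.
Proof. by move=> px ky; rewrite inner_prodC inner_prod_kp. Qed.

Lemma inner_prod_ge0 u :
  (forall x, k x -> x != 0 -> B x x < 0) ->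
  (forall x, p x -> x != 0 -> 0 < B x x) -> 0 <= ip u u.
Proof.
move=> Bk Bp; have [u1 [u2 [pu ku ->]]] := cartan u.
rewrite inner_prodDl !inner_prodDr (inner_prod_kp ku pu) (inner_prod_pk pu ku).
rewrite addr0 add0r /inner_prod pu ku BNr opprK.
have B00 := B0l 0.
have [->|/(Bp _ pu)] := eqVneq u1 0; have [->|/(Bk _ ku)] := eqVneq u2 0; lra.
Qed.

Let brDl u u' v : br (u + u') v = br u v + br u' v.
Proof. by have := br_lin v 1 u u'; rewrite !scale1r. Qed.

Let br0l v : br 0 v = 0.
Proof. by apply: (addrI (br 0 v)); rewrite -brDl !addr0. Qed.

Let brNl u v : br (- u) v = - br u v.
Proof. by apply: (addrI (br u v)); rewrite -brDl !subrr br0l. Qed.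

Let brDr u v v' : br u (v + v') = br u v + br u v'.
Proof. by rewrite ![br u _]brC brDl opprD. Qed.

Let brNr u v : br u (- v) = - br u v.
Proof. by rewrite ![br u _]brC brNl. Qed.

Lemma br_pp x y : p x -> p y -> k (br x y).
Proof. by rewrite /pp /kk /= => px py; rewrite theta_br px py brNl brNr opprK. Qed.

Lemma br_kk x y : k x -> k y -> k (br x y).
Proof. by rewrite /kk /= => kx ky; rewrite theta_br kx ky. Qed.

Lemma br_pk x y : p x -> k y -> p (br x y).
Proof. by rewrite /pp /kk /= => px ky; rewrite theta_br px ky brNl. Qed.

Lemma br_kp x y : k x -> p y -> p (br x y).
Proof. by rewrite /pp /kk /= => kx py; rewrite theta_br kx py brNr. Qed.

(** Twisting the invariant form by [theta] makes the transpose of [br v] equal to [- br (theta v)];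
    this is the source of the [theta] terms in the connection. *)
Lemma inner_prod_ad u v w : ip (br v w) u = - ip w (br (theta v) u).
Proof.
rewrite /inner_prod theta_br thetaK; have := B_ad v w (theta u); lra.
Qed.

Definition lc_product u v : g :=
  2^-1 *: (br u v - br u (theta v) - br v (theta u)).

Lemma koszul u v w :
  2 * ip (lc_product u v) w = ip (br u v) w - ip (br v w) u - ip (br u w) v.
Proof.
rewrite inner_prodZl mulrA mulfV ?mul1r; last by rewrite pnatr_eq0.
rewrite !inner_prodDl !inner_prodNl.
rewrite (inner_prod_ad u v w) (inner_prod_ad v u w) ![ip w _]inner_prodC.
by rewrite [br (theta v) u]brC [br (theta u) v]brC !inner_prodNl; ring.
Qed.

Section Sectional.
Variables u1 u2 v1 v2 : g.
Hypotheses (pu : p u1) (ku : k u2) (pv : p v1) (kv : k v2).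
Let a := br u1 v1.
Let b := br u2 v2.
Let c := br u1 v2.
Let d := br u2 v1.

Let lc_productE z : ip (lc_product (u1 + u2) (v1 + v2)) z =
  2^-1 * (ip a z + ip b z - ip c z + 3 * ip d z).
Proof.
rewrite inner_prodZl; congr (_ * _).
rewrite !(linearD theta) pu ku pv kv !(brDl, brDr, brNl, brNr).
rewrite [br v1 u1]brC [br v1 u2]brC [br v2 u1]brC [br v2 u2]brC.
by rewrite -/a -/b -/c -/d !(inner_prodDl, inner_prodNl); ring.
Qed.

Let lc_productCE z : ip (lc_product (v1 + v2) (u1 + u2)) z =
  2^-1 * (- ip a z - ip b z - 3 * ip c z + ip d z).
Proof.
rewrite inner_prodZl; congr (_ * _).
rewrite !(linearD theta) pu ku pv kv !(brDl, brDr, brNl, brNr).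
rewrite [br v1 u1]brC [br v1 u2]brC [br v2 u1]brC [br v2 u2]brC.
by rewrite -/a -/b -/c -/d !(inner_prodDl, inner_prodNl); ring.
Qed.

Let B_adr x y z : B (br x y) z = - B y (br x z).
Proof. by apply/eqP; rewrite -addr_eq0 B_ad. Qed.

(** Invariance of [B] moves [v2] to the other side, the Jacobi identity writes [br v2 (br u1 u2)] as
    [br u2 c - br u1 b], and invariance moves [u2] and [u1] back onto [v1]. The signs come from [ip]
    being [B] on p and [- B] on k. *)
Let inner_prod_pkpk : ip (br v1 v2) (br u1 u2) = - ip c d - ip a b.
Proof.
have pd : theta d = - d by exact: br_kp.
have kb : theta b = b by exact: br_kk.
have pw : theta (br u1 u2) = - br u1 u2 by exact: br_pk.
have E : br v2 (br u1 u2) = br u2 c - br u1 b.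
  rewrite brJ [br v2 u1]brC [br v2 u2]brC -/b -/c brNl brNr.
  by rewrite [br c u2]brC opprK.
have Ec := B_adr u2 v1 c; have Eb := B_adr u1 v1 b.
rewrite /inner_prod pd kb pw !BNr !opprK [br v1 v2]brC BNl B_adr opprK E BDr BNr.
by rewrite (B_sym c d); move: Ec Eb; rewrite -/a -/d; lra.
Qed.

Let inner_prod_brxx x z : ip (br x x) z = 0.
Proof. by have := congr1 (ip ^~ z) (brC x x); rewrite /= inner_prodNl; lra. Qed.

(** For equal arguments $a = b = 0$ and $d = -c$, so $\frac12(a+b-c+3d) = -2c$. *)
Let lc_product_diag x1 x2 z : p x1 -> k x2 ->
  ip (lc_product (x1 + x2) (x1 + x2)) z = - 2 * ip (br x1 x2) z.
Proof.
move=> px kx; rewrite inner_prodZl !(linearD theta) px kx !(brDl, brDr, brNl, brNr).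
rewrite [br x2 x1]brC !(inner_prodDl, inner_prodNl) !inner_prod_brxx.
by field.
Qed.

Lemma sectional_curvature_formula (u := u1 + u2) (v := v1 + v2) :
  - ip (lc_product v v) (lc_product u u)
  + ip (lc_product v u) (lc_product u v) - ip (lc_product (br u v) v) u =
  - 2 * ip a a + 1 / 4 * ip (br u v) (br u v) + 2 * ip a b.
Proof.
have ka : k a by exact: br_pp.
have kb : k b by exact: br_kk.
have pc : p c by exact: br_pk.
have pd : p d by exact: br_kp.
(* As k and p are orthogonal, only products within the pair [a], [b] or within the pair [c], [d]
   survive. *)
have Z := (inner_prod_kp ka pc, inner_prod_kp ka pd, inner_prod_kp kb pc,
  inner_prod_kp kb pd, inner_prod_pk pc ka, inner_prod_pk pd ka,
  inner_prod_pk pc kb, inner_prod_pk pd kb).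
have wE : br u v = a + b + c + d.
  rewrite /u /v !(brDl, brDr) -/a -/b -/c -/d.
  by apply: inner_prod_eq => z; rewrite !inner_prodDl; ring.
have T1 : ip (lc_product v v) (lc_product u u) = 4 * (- ip c d - ip a b).
  rewrite lc_product_diag// inner_prodC lc_product_diag// inner_prodC.
  by rewrite inner_prod_pkpk; ring.
(* In the Koszul formula for $w = [u,v]$ the middle term is $\|w\|^2$; transposing the other two
   isolates $w$ against a vector that [tE] evaluates as $2(a-b)$. *)
have T3 : 2 * ip (lc_product (br u v) v) u =
    ip (br u v) (br u v) + ip (br u v) (br (theta v) u - br (theta u) v).
  have K w : ip (br w v) u - ip (br w u) v =
      ip w (br (theta v) u - br (theta u) v).
    rewrite [br w v]brC [br w u]brC !inner_prodNl inner_prodDr inner_prodNr.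
    by rewrite (inner_prod_ad u v w) (inner_prod_ad v u w); ring.
  by rewrite koszul -K [br v u]brC inner_prodNl; ring.
have tE : br (theta v) u - br (theta u) v = 2 *: (a - b).
  rewrite /u /v !(linearD theta) pu ku pv kv !(brDl, brDr, brNl, brNr).
  rewrite [br v1 u1]brC [br v1 u2]brC [br v2 u1]brC [br v2 u2]brC.
  apply: inner_prod_eq => z.
  by rewrite -/a -/b -/c -/d !(inner_prodDl, inner_prodNl, inner_prodZl); ring.
have T2 : ip (lc_product v u) (lc_product u v) =
    - 1 / 4 * (ip a a + ip b b + 2 * ip a b) + 3 / 4 * (ip c c + ip d d)
    - 5 / 2 * ip c d.
  rewrite lc_productCE ![ip _ (lc_product u v)]inner_prodC !lc_productE.
  rewrite !Z (inner_prodC b a) (inner_prodC d c).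
  by field.
have ww : ip (br u v) (br u v) = ip a a + ip b b + 2 * ip a b
    + (ip c c + ip d d + 2 * ip c d).
  rewrite wE !(inner_prodDl, inner_prodDr) !Z.
  by rewrite (inner_prodC b a) (inner_prodC d c); ring.
have wt : ip (br u v) (2 *: (a - b)) = 2 * (ip a a - ip b b).
  rewrite inner_prodC inner_prodZl wE !(inner_prodDl, inner_prodNl, inner_prodDr).
  by rewrite !Z (inner_prodC b a); ring.
by move: T3; rewrite tE wt T1 T2 ww; lra.
Qed.

End Sectional.
End CartanAlgebra.

(** * The Levi-Civita axioms on left invariant fields *)

Section LeviCivita.
Context {R : realType} {n : nat} {G : groupTopologicalType}.
Variable A : set (chart R n G).
Hypothesis hG : lie_group A.
Variables (g : vectType R) (br : g -> g -> g) (lf : g -> (G -> R) -> G -> R).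
Hypothesis hg : lie_algebra_of A br lf.
Variables (ip : g -> g -> R) (nabla : (G -> g) -> (G -> g) -> G -> g).
Hypothesis hnabla : levi_civita A lf ip nabla.

Lemma smooth_field_cst (u : g) : smooth_field A (cst u : G -> g).
Proof. by move=> phi; exact: (smooth_fun_cst (phi u)). Qed.

(** Equality in [g] is tested at the identity, while the torsion axiom is wanted at [a]; translating
    the test function by [a^-1] matches the two. *)
Lemma lc_torsion_cst u v a :
  nabla (cst u) (cst v) a - nabla (cst v) (cst u) a = br u v.
Proof.
apply: (lf_eq hG hg) => f sf; rewrite -(mulVg a).
have sf' : smooth_fun A (fun x => f (a^-1 * x)%g) by exact: smooth_fun_mull.
rewrite -!(lif_invariant (lf_field hg _))// (lf_bracket hg)//.
exact: (lc_torsion hnabla (smooth_field_cst u) (smooth_field_cst v) sf').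
Qed.

(** The inner product of two constant fields is a constant function, which every field
    annihilates. *)
Lemma lc_metric_cst u v w a :
  ip (nabla (cst u) (cst v) a) w + ip v (nabla (cst u) (cst w) a) = 0.
Proof.
have := lc_metric hnabla (smooth_field_cst u) (smooth_field_cst v)
  (smooth_field_cst w) a.
by rewrite /field_act /= => <-; exact: (lf_cst hg).
Qed.

End LeviCivita.

Theorem theorem4p4 (R : realType) (n : nat) (G : groupTopologicalType)
  (A : set (chart R n G)) (hG : lie_group A)
  (g : vectType R) (br : g -> g -> g) (lf : g -> (G -> R) -> G -> R)
  (hg : lie_algebra_of A br lf)
  (expG : g -> G) (hexp : is_exponential A lf expG)
  (K : set G) (theta : {linear g -> g}) (B : g -> g -> R)
  (hGK : harish_chandra A br lf expG K theta B)
  (nabla : (G -> g) -> (G -> g) -> G -> g)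
  (hnabla : levi_civita A lf (inner_prod theta B) nabla) :
  let ip := inner_prod theta B in
  let nrm := inner_norm theta B in
  let k := kk theta in
  let p := pp theta in
  let sec u v := fun a : G => ip (curvature br nabla u v v a) u in
  [/\ (forall u v u1 u2 v1 v2 : g,
         p u1 -> k u2 -> u = u1 + u2 -> p v1 -> k v2 -> v = v1 + v2 ->
         forall a, sec u v a = - 2 * nrm (br u1 v1) ^+ 2
                               + 1 / 4 * nrm (br u v) ^+ 2
                               + 2 * ip (br u1 v1) (br u2 v2)),
      (forall u v : g, p u -> p v -> forall a,
         sec u v a = - (7 / 4) * nrm (br u v) ^+ 2 /\ sec u v a <= 0),
      (forall u v : g, k u -> k v -> forall a,
         sec u v a = 1 / 4 * nrm (br u v) ^+ 2 /\ 0 <= sec u v a),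
      (forall u v : g, p u -> k v -> forall a,
         sec u v a = 1 / 4 * nrm (br u v) ^+ 2 /\ 0 <= sec u v a)
    & (forall u v : g, k v -> forall a,
         sec u v a = 1 / 4 * nrm (br u v) ^+ 2 /\ 0 <= sec u v a) /\
      (forall u v u1 u2 : g, p u1 -> k u2 -> u = u1 + u2 -> p v -> forall a,
         sec u v a = - (7 / 4) * nrm (br u1 v) ^+ 2
                     + 1 / 4 * nrm (br u2 v) ^+ 2)].
Proof.
move=> ip nrm k p sec.
have br_lin := br_linear hG hg; have brC := br_anti hG hg.
have brJ := br_jacobi hG hg.
have [_ _ theta_br thetaK B_lin B_sym B_nondeg B_Ad _ cartan B_orth Bk Bp _ _ _] := hGK.
have B_ad := invariant_form_ad hG hg hexp B_lin B_sym B_Ad.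
have ipC x y : ip x y = ip y x := inner_prodC thetaK B_lin B_sym cartan B_orth x y.
have ipDl x y z : ip (x + y) z = ip x z + ip y z := inner_prodDl theta B_lin x y z.
have ipDr x y z : ip x (y + z) = ip x y + ip x z by rewrite ipC ipDl !(ipC x).
have ipNl x y : ip (- x) y = - ip x y := inner_prodNl theta B_lin x y.
have ip0 x : ip 0 x = 0 := inner_prod0l theta B_lin x.
have ipkp x y : k x -> p y -> ip x y = 0 by exact: inner_prod_kp.
have nrmE x : nrm x ^+ 2 = ip x x.
  by rewrite sqr_sqrtr//; exact: (inner_prod_ge0 thetaK B_lin B_sym cartan B_orth _ Bk Bp).
have nrm_ge0 x : 0 <= nrm x ^+ 2 by rewrite exprn_ge0// sqrtr_ge0.
pose N := lc_product br theta.
(* At a fixed point, three metric and three torsion identities form a linear system that determines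
   the value against every [w]. *)
have nablaE u v : nabla (cst u) (cst v) = cst (N u v).
  apply/funext => a /=.
  apply: (inner_prod_eq thetaK B_lin B_nondeg) => w.
  have Kuvw := koszul brC theta_br thetaK B_lin B_sym B_ad cartan B_orth u v w.
  pose T x y z := ip (nabla (cst x) (cst y) a) z.
  have Tm x y z : T x y z + T x z y = 0.
    by rewrite -(lc_metric_cst hg hnabla x y z a); congr (_ + _); exact: ipC.
  have Tt x y z : T x y z - T y x z = ip (br x y) z.
    by rewrite -(lc_torsion_cst hG hg hnabla x y a) ipDl ipNl.
  have := (Tm u v w, Tm v u w, Tm w u v).
  have := (Tt u v w, Tt v w u, Tt u w v).
  rewrite -[inner_prod _ _ (nabla _ _ _) _]/(T u v w) -/(ip _ _).
  move: Kuvw; rewrite -!/(ip _ _) -/(N u v).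
  by case=> ? [[? ?] ?] [[? ?] ?]; lra.
(* [M] says that each [N x] is skew for [ip]; it transfers the outer derivative of both second-order
   terms to the other argument. *)
have secE u v a : sec u v a =
    - ip (N v v) (N u u) + ip (N v u) (N u v) - ip (N (br u v) v) u.
  have M x y z : ip (N x y) z = - ip (N x z) y.
    apply/eqP; rewrite -addr_eq0; apply/eqP.
    have := lc_metric_cst hg hnabla x y z 1%g.
    by rewrite !nablaE /= => <-; congr (_ + _); rewrite ipC.
  rewrite /sec /curvature !nablaE /= !ipDl !ipNl.
  rewrite (M u) (M v (N u v)). rewrite (opprK (ip (N v u) _)).
  by rewrite (ipC (N u u)).
have formula u v u1 u2 v1 v2 : p u1 -> k u2 -> u = u1 + u2 ->
    p v1 -> k v2 -> v = v1 + v2 -> forall a,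
    sec u v a = - 2 * ip (br u1 v1) (br u1 v1) + 1 / 4 * ip (br u v) (br u v)
                + 2 * ip (br u1 v1) (br u2 v2).
  move=> pu ku -> pv kv -> a; rewrite secE.
  exact: (sectional_curvature_formula br_lin brC brJ theta_br thetaK B_lin B_sym
    B_nondeg B_ad cartan B_orth).
have p0 : p 0 by rewrite /p /pp /= linear0 oppr0.
have k0 : k 0 by rewrite /k /kk /= linear0.
have br0 x : br 0 x = 0.
  by have /(congr1 (fun y => y - br 0 x)) := br_lin x 1 0 0;
    rewrite !scale1r addr0 addrK subrr.
have br0r x : br x 0 = 0 by rewrite brC br0 oppr0.
have ip0r x : ip x 0 = 0 by rewrite ipC ip0.
(* With $v_1 = 0$ both terms containing $[u_1,v_1]$ vanish. Cases (2) and (3) are instances of this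
   one. *)
have right_k u v : k v -> forall a,
    sec u v a = 1 / 4 * nrm (br u v) ^+ 2 /\ 0 <= sec u v a.
  move=> kv a; have [u1 [u2 [pu ku uE]]] := cartan u.
  suff E : sec u v a = 1 / 4 * nrm (br u v) ^+ 2.
    by split=> //; rewrite E; have := nrm_ge0 (br u v); lra.
  rewrite (formula _ _ _ _ 0 v pu ku uE p0 kv (esym (add0r v))) br0r nrmE.
  by rewrite !ip0; ring.
split.
- move=> u v u1 u2 v1 v2 pu ku uE pv kv vE a; rewrite !nrmE.
  exact: formula.
- move=> u v pu pv a.
  suff E : sec u v a = - (7 / 4) * nrm (br u v) ^+ 2.
    by split=> //; rewrite E; have := nrm_ge0 (br u v); lra.
  rewrite (formula _ _ u 0 v 0 pu k0 (esym (addr0 u)) pv k0 (esym (addr0 v))).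
  by rewrite br0 ip0r nrmE; field.
- by move=> u v _; exact: right_k.
- by move=> u v _; exact: right_k.
split=> // u v u1 u2 pu ku uE pv a.
(* Here $v_2 = 0$. As $[u_1,v]$ lies in k and $[u_2,v]$ in p, the term $\frac14\|[u,v]\|^2$ splits,
   and $-2+\frac14 = -\frac74$. *)
rewrite (formula _ _ u1 u2 v 0 pu ku uE pv k0 (esym (addr0 v))) br0r ip0r !nrmE.
have -> : br u v = br u1 v + br u2 v.
  by rewrite uE; have := br_lin v 1 u1 u2; rewrite !scale1r.
have k1 : k (br u1 v) by exact: (br_pp br_lin brC theta_br).
have p2 : p (br u2 v) by exact: (br_kp br_lin brC theta_br).
rewrite ipDl !ipDr (ipC (br u2 v) (br u1 v)) (ipkp _ _ k1 p2).
by field.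
Qed.
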